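(* For all positive integers $k$ and $n$, $$\sum_{\substack{1\le a_1,\ldots, a_k\le n \\ (a_1\cdots a_k,n)=1 \\ (a_1+\cdots+a_k,n)=1}} (a_1+\cdots +a_k-1,\,n) = \varphi_k(n)\,\tau(n).$$
   Context: $(a,b)$ denotes the greatest common divisor (with $(0,n)=n$), and $\tau(n)$ is the number of positive divisors of $n$. The sum on the left is over ordered $k$-tuples of integers satisfying the indicated conditions. For positive integers $k,n$, $\varphi_k(n)$ denotes the number of ordered $k$-tuples of integers $(a_1,\ldots,a_k)$ with $1\le a_1,\ldots,a_k\le n$ such that $(a_1\cdots a_k,n)=1$ and $(a_1+\cdots+a_k,n)=1$. *)

(* Defs.v *)
From mathcomp Require Import all_boot.

Set Implicit Arguments.
Unset Strict Implicit.
Unset Printing Implicit Defensive.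

(* Integer k-tuples with entries in [1, n]: 'I_n.+1 is {0, ..., n}, so the
   upper bound is carried by the type and only the lower bound is imposed. *)
Definition unit_tuples (k n : nat) : {set {ffun 'I_k -> 'I_n.+1}} :=
  [set a : {ffun 'I_k -> 'I_n.+1} |
    [&& [forall i, 1 <= a i],
        gcdn (\prod_(i < k) a i) n == 1
      & gcdn (\sum_(i < k) a i) n == 1]].

Definition varphi (k n : nat) : nat := #|unit_tuples k n|.

Definition tau (n : nat) : nat := size (divisors n).

(* Main.v *)
Require Import Defs.
From mathcomp Require Import all_boot.
From mathcomp Require Import cyclic.

Set Implicit Arguments.
Unset Strict Implicit.
Unset Printing Implicit Defensive.

(** Write S(a) for the sum of the entries of a tuple a.  Gauss's identity,
    applied to gcd(S(a) - 1, n), gives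

      gcd(S(a) - 1, n) = sum of totient d over the d | n with S(a) = 1 (mod d),

    so after exchanging the sums the left-hand side is the sum over d | n of
    totient d * N_d(1), where N_d(s) counts the unit tuples with
    S(a) = s (mod d).  It is enough that each of these terms is varphi k n.

    For d | n the sum of a unit tuple is a unit mod d, so varphi k n is the sum
    of N_d(s) over the totient d unit classes s.  These N_d(s) are all equal:
    every unit mod d lifts to a unit mod n ([unit_lift]), and multiplying all
    the entries by such a unit u permutes the unit tuples while it multiplies S
    by u ([card_fiber_le]).  Hence varphi k n = totient d * N_d(1)
    ([varphi_fiber]), and summing over the tau n divisors d concludes. *)

(** The lift is built by the Chinese remainder theorem: n splits into the part
    supported on the primes of d, where coprimality to n is already forced by
    the residue mod d, and the part coprime to d, where u = 1 may be imposed.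
    The inverse of s mod d is written as a power of s by Euler's theorem. *)
Lemma unit_lift d n s t : 0 < n -> d %| n -> coprime s d -> coprime t d ->
  exists2 u, coprime u n & u * s = t %[mod d].
Proof.
move=> n0 dn cs ct; have d0 := dvdn_gt0 n0 dn.
(* the summand d only makes w positive, which matters when d = 1 *)
set w := t * s ^ (totient d).-1 + d.
have w0 : 0 < w by rewrite addn_gt0 d0 orbT.
have cw : coprime w d.
  by rewrite -coprime_modl modnDr coprime_modl coprimeMl ct coprimeXl.
have dn1 : d %| n`_\pi(d).
  by rewrite -[d in d %| _](part_pnat_id (pnat_pi d0)) partn_dvd.
have cop := coprime_partC \pi(d) n n.
exists (chinese n`_\pi(d) n`_\pi(d)^' w 1).
  rewrite -{3}(partnC \pi(d) n0) coprimeMr -[X in X && _]coprime_modl.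
  rewrite chinese_modl // coprime_modl -[X in _ && X]coprime_modl.
  rewrite chinese_modr // coprime_modl coprime1n andbT.
  rewrite coprime_sym; apply: pnat_coprime (part_pnat _ _) _.
  by rewrite -coprime_pi' // coprime_sym.
rewrite -modnMml -(modn_dvdm (chinese _ _ _ _) dn1) chinese_modl // modn_dvdm //.
rewrite /w modnDr modnMml -mulnA -expnSr prednK ?totient_gt0 //.
by rewrite -modnMmr Euler_exp_totient // modnMmr muln1.
Qed.

(** The representative in [1, n], rather than [0, n - 1], of a residue class. *)
Definition pos_rep (n m : nat) : 'I_n.+1 := inord ((m + n.-1) %% n).+1.

Lemma val_pos_rep n m : 0 < n -> pos_rep n m = ((m + n.-1) %% n).+1 :> nat.
Proof. by move=> n0; rewrite inordK // ltnS ltn_pmod. Qed.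

Lemma pos_rep_mod n m : 0 < n -> pos_rep n m = m %[mod n].
Proof.
by move=> n0; rewrite val_pos_rep // -addn1 modnDml -addnA addn1 prednK // modnDr.
Qed.

Lemma pos_rep_inj_mod n (x y : 'I_n.+1) :
  0 < x -> 0 < y -> x = y %[mod n] -> x = y.
Proof.
move=> x0 y0 xy; apply: val_inj => /=.
have [xn yn] := (ltn_ord x, ltn_ord y).
have n0 : 0 < n by apply: leq_trans x0 _.
rewrite -(prednK x0) -(prednK y0); congr _.+1.
rewrite -(@modn_small x.-1 n) ?prednK // -(@modn_small y.-1 n) ?prednK //.
by apply/eqP; rewrite -(eqn_modDr 1) !addn1 !prednK //; apply/eqP.
Qed.

Lemma coprime_modMl_inj u n x y :
  coprime u n -> u * x = u * y %[mod n] -> x = y %[mod n].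
Proof.
move=> cu; wlog yx : x y / y <= x => [W|].
  by case: (leqP y x) => [|/ltnW] le E; [|symmetry]; apply: W.
move/eqP; rewrite eqn_mod_dvd ?leq_mul2l ?yx ?orbT // -mulnBr.
by rewrite Gauss_dvdr 1?coprime_sym // -eqn_mod_dvd // => /eqP.
Qed.

Lemma unit_tuplesP k n (a : {ffun 'I_k -> 'I_n.+1}) :
  reflect [/\ forall i, 0 < a i, forall i, coprime (a i) n
            & coprime (\sum_(i < k) a i) n]
          (a \in unit_tuples k n).
Proof.
rewrite inE; apply: (iffP and3P) => [[/forallP a0 cp cs]|[a0 ca cs]].
  split=> // i; move: cp; rewrite -[_ == 1]/(coprime _ _) (bigD1 i) //=.
  by rewrite coprimeMl => /andP[].
split=> //; first exact/forallP.
rewrite -[_ == 1]/(coprime _ _); elim/big_ind: _ => //; first exact: coprime1n.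
by move=> x y cx cy; rewrite coprimeMl cx.
Qed.

Definition sum_fiber (k n d s : nat) : {set {ffun 'I_k -> 'I_n.+1}} :=
  [set a in unit_tuples k n | \sum_(i < k) a i == s %[mod d]].

(** Multiplying all entries by a unit u of Z/n with u * s = t (mod d) embeds the
    fiber over s into the fiber over t. *)
Lemma card_fiber_le k n d s t : 0 < n -> d %| n ->
  coprime s d -> coprime t d -> #|sum_fiber k n d s| <= #|sum_fiber k n d t|.
Proof.
move=> n0 dn cs ct; have [u cu us] := unit_lift n0 dn cs ct.
pose f (a : {ffun 'I_k -> 'I_n.+1}) := [ffun i => pos_rep n (u * a i)].
have f_inj : {in sum_fiber k n d s &, injective f}.
  move=> a b /setIdP[/unit_tuplesP[a0 _ _] _] /setIdP[/unit_tuplesP[b0 _ _] _].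
  move=> /ffunP fab; apply/ffunP => i; apply: pos_rep_inj_mod => //.
  apply: (coprime_modMl_inj cu).
  rewrite -(pos_rep_mod _ n0) -[RHS](pos_rep_mod _ n0).
  by move: (fab i); rewrite !ffunE => ->.
rewrite -(card_in_imset f_inj); apply/subset_leq_card/subsetP => _ /imsetP[a aF ->].
case/setIdP: aF => /unit_tuplesP[a0 ca cS] /eqP aS.
have fS : \sum_(i < k) f a i = u * \sum_(i < k) a i %[mod n].
  rewrite -modn_summ big_distrr /= -[RHS]modn_summ; congr (_ %% _).
  by apply: eq_bigr => i _; rewrite ffunE pos_rep_mod.
apply/setIdP; split; last first.
  by rewrite -(modn_dvdm _ dn) fS modn_dvdm // -modnMmr aS modnMmr us.
apply/unit_tuplesP; split=> [i|i|].
- by rewrite ffunE val_pos_rep.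
- by rewrite ffunE -coprime_modl pos_rep_mod // coprime_modl coprimeMl cu ca.
- by rewrite -coprime_modl fS coprime_modl coprimeMl cu.
Qed.

(** The unit tuples are equidistributed over the units mod d; the fiber over 1
    serves as the reference one. *)
Lemma varphi_fiber k n d : 0 < n -> d %| n ->
  varphi k n = totient d * #|sum_fiber k n d 1|.
Proof.
move=> n0 dn; have d0 := dvdn_gt0 n0 dn.
pose p (a : {ffun 'I_k -> 'I_n.+1}) := Ordinal (ltn_pmod (\sum_(i < k) a i) d0).
rewrite /varphi -sum1_card (partition_big p (fun s : 'I_d => coprime d s)) /=.
  rewrite totient_count_coprime big_mkord big_distrl /= big_mkcond /=.
  apply: eq_bigr => s _; case: ifP => [cds|]; rewrite ?mul0n ?mul1n //.
  have csd : coprime s d by rewrite coprime_sym.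
  transitivity #|sum_fiber k n d s|.
    rewrite -sum1_card; apply: eq_bigl => a.
    by rewrite [RHS]inE -val_eqE /= (modn_small (ltn_ord s)).
  by apply/eqP; rewrite eqn_leq !card_fiber_le ?coprime1n.
move=> a /unit_tuplesP[_ _ cS].
by rewrite /= coprime_sym coprime_modl (coprime_dvdr dn).
Qed.

(** Gauss's identity for gcdn m n, whose divisors are the common ones. *)
Lemma gcdn_sum_totient m n : 0 < n ->
  gcdn m n = \sum_(d <- divisors n | d %| m) totient d.
Proof.
move=> n0; have g0 : 0 < gcdn m n by rewrite gcdn_gt0 n0 orbT.
rewrite -{1}(sum_totient_dvd (gcdn m n)).
rewrite -(big_mkord (fun d => d %| gcdn m n)) -[RHS]big_filter.
rewrite -[LHS]big_filter; apply: perm_big; apply: uniq_perm.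
- by rewrite filter_uniq ?iota_uniq.
- by rewrite filter_uniq ?divisors_uniq.
move=> d; rewrite !mem_filter -dvdn_divisors // mem_index_iota /= ltnS dvdn_gcd.
by apply: andb_idr => dmn; rewrite dvdn_leq // dvdn_gcd.
Qed.

Theorem corollary2p5 (k n : nat) (k_gt0 : 0 < k) (n_gt0 : 0 < n) :
  \sum_(a in unit_tuples k n) gcdn ((\sum_(i < k) a i) - 1) n
    = varphi k n * tau n.
Proof.
under eq_bigr => a _ do rewrite gcdn_sum_totient // big_mkcond /=.
rewrite exchange_big /= /tau -sum1_size big_distrr /= !big_seq.
apply: eq_bigr => d; rewrite -dvdn_divisors // => dn.
rewrite muln1 (varphi_fiber k n_gt0 dn) -big_mkcondr sum_nat_const mulnC.
congr (_ * _); apply: eq_card => a; rewrite [RHS]inE.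
apply: andb_id2l => /unit_tuplesP[a0 _ _].
(* the truncated subtraction is exact because the sum is at least its first entry *)
rewrite eqn_mod_dvd // (bigD1 (Ordinal k_gt0)) //=.
exact: leq_trans (a0 _) (leq_addr _ _).
Qed.
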